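(* Let $\mathcal{D}$ be a strong digraph (at most countable). Then either (A) for any positive function $g:\mathbb{N}\to(0,\infty)$ there exists $M\in\mathcal{T}(\mathcal{D})$ such that $\lambda(M)-\lambda_n(M)<g(n)$ for every $n\ge 1$; or (B) for any $M\in\mathcal{T}(\mathcal{D})$ there exists $c_M>0$, not depending on $n$, such that $n\bigl(\lambda(M)-\lambda_n(M)\bigr)>c_M$ for every $n\ge1$. Moreover, the latter alternative (B) holds if and only if $\mathcal{D}$ admits a finite cycle transversal.
   Context: Digraphs may have loops, but have no multiple arcs. A digraph is strong (strongly connected) if for any two distinct vertices $v,w$ there is a directed path from $v$ to $w$; by convention each vertex of a strong digraph has at least one arc leaving it (so a single vertex without a loop is not considered). ''Cycle'' means directed cycle without repeated vertices (loops are cycles of length 1, pairs of opposite arcs are cycles of length 2). A cycle transversal of $\mathcal{D}$ is a set of vertices whose deletion (with all incident arcs) leaves a digraph with no cycles. The digraph of a matrix has the index-set as vertex-set, and $(v,w)$ is an arc if and only if the $(v,w)$ entry is non-zero. For an infinite non-negative matrix $M$ (entrywise non-negative, real), $\lambda_n(M)$ is the supremum of the spectral radii of its principal submatrices of order $n$, and $\lambda(M)=\lim_{n\to\infty}\lambda_n(M)$, i.e. the supremum of the spectral radii of all finite principal submatrices; it is always assumed that $\lambda(M)<\infty$. Such an $M$ is transient if the series $\sum_{p=0}^{\infty}M^pz^{-p}$ converges entrywise at $z=\lambda(M)$ (it always converges for $z>\lambda(M)$), and recurrent otherwise. $\mathcal{T}(\mathcal{D})$ is the class of all transient non-negative matrices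 $M$ (with $\lambda(M)<\infty$) whose digraph is $\mathcal{D}$. ($\mathcal{T}(\mathcal{D})$ may be empty, e.g. when $\mathcal{D}$ is finite, in which case (B) holds vacuously.) *)

(* Defs.v *)
From mathcomp Require Import all_boot all_order all_algebra.
From mathcomp Require Import all_classical all_reals all_analysis.
From mathcomp Require Import complex.

Set Implicit Arguments.
Unset Strict Implicit.
Unset Printing Implicit Defensive.

Import Order.TTheory GRing.Theory Num.Theory.

Local Open Scope classical_set_scope.
Local Open Scope ring_scope.

(* A digraph on an at most countable vertex set is a relation E : rel V on
   V : countType. *)
Section Digraphs.
Variable V : countType.
Implicit Types (E : rel V) (S : set V).

Definition dipath E (v w : V) (p : seq V) : Prop :=
  [/\ path E v p, last v p = w & uniq (v :: p)].

(* The empty digraph is not strong. *)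
Definition strong E : Prop :=
  [/\ [set: V] !=set0,
      forall v w, v != w -> exists p, dipath E v w p
    & forall v, exists w, E v w].

(* [:: v] is a cycle iff v carries a loop, [:: v; w] iff v != w and both
   opposite arcs are present. *)
Definition dicycle E (c : seq V) : Prop := c <> [::] /\ ucycle E c.

(* The vertices of S remain in the type V, but as isolated loopless vertices. *)
Definition delete E S : rel V :=
  [rel v w | [&& v \notin S, w \notin S & E v w]].

Definition cycle_transversal E S : Prop :=
  forall c, ~ dicycle (delete E S) c.

End Digraphs.

Section SpectralRadius.
Variables (R : realType) (n : nat).

(* Largest modulus of a complex eigenvalue (0 when n = 0). *)
Definition spectral_radius (A : 'M[R]_n) : R :=
  sup [set ComplexField.Normc.normc z
      | z in [set z : R[i] | eigenvalue (map_mx (real_complex R) A) z]].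

End SpectralRadius.

Section InfiniteMatrices.
Variables (R : realType) (V : countType).
Implicit Types (M : V -> V -> R) (E : rel V).

Definition nonneg_mat M : Prop := forall v w, 0 <= M v w.

Definition digraph_of M : rel V := [rel v w | M v w != 0].

Definition principal M n (f : 'I_n -> V) : 'M[R]_n :=
  \matrix_(i, j) M (f i) (f j).

(* An order-n principal submatrix is taken along an enumeration f of its index
   set; another enumeration gives a permutation-similar matrix, hence the same
   spectral radius. If #|V| < n the supremum is -oo. *)
Definition lambda_n M n : \bar R :=
  ereal_sup [set (spectral_radius (principal M f))%:E
            | f in [set f : 'I_n -> V | injective f]].

(* For infinite V, also the limit of the nondecreasing sequence lambda_n M. *)
Definition lambda M : \bar R := ereal_sup (range (lambda_n M)).

(* For nonnegative M; the possibly infinite sum is taken in [0, +oo]. *)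
Fixpoint mat_pow M (p : nat) (v w : V) : \bar R :=
  if p is q.+1 then (\esum_(u in [set: V]) ((M v u)%:E * mat_pow M q u w))%E
  else ((v == w)%:R : R)%:E.

(* Every series below has nonnegative terms, so that it converges in R
   iff its sum in [0, +oo] is finite. *)
Definition transient M : Prop :=
  forall v w,
    (\sum_(0 <= p <oo) (mat_pow M p v w * ((fine (lambda M)) ^- p)%:E) < +oo)%E.

Definition transient_class E M : Prop :=
  [/\ nonneg_mat M, digraph_of M =2 E, (lambda M < +oo)%E & transient M].

Definition arbitrarily_fast_approx E : Prop :=
  forall g : nat -> R, (forall n, 0 < g n) ->
  exists2 M, transient_class E M &
    forall n, (1 <= n)%N -> (lambda M - lambda_n M n < (g n)%:E)%E.

Definition inverse_linear_gap E : Prop :=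
  forall M, transient_class E M ->
  exists2 c : R, 0 < c &
    forall n, (1 <= n)%N -> (c%:E < n%:R%:E * (lambda M - lambda_n M n))%E.

End InfiniteMatrices.

(* Main.v *)
Require Import Defs.
From mathcomp Require Import all_boot all_order all_algebra.
From mathcomp Require Import all_classical all_reals all_analysis.
From mathcomp Require Import complex.
From mathcomp Require Import ring lra.

(* If [S] is a finite cycle transversal and [M] is transient, sum the columns of
   the Green function at the vertices of [S] to get a positive [g] with
   [M g <= lambda (g - 1_S)]. In a principal submatrix of order [n] the part
   outside [S] is acyclic, so damping [g] by powers of [q = 1 - 1 / (U (n + 1))]
   along this acyclic part gives a positive [x] with [M x <= lambda q x]; hence
   [lambda_n <= lambda q], where [U] bounds [g] on [S].
   If there is no finite cycle transversal, there are infinitely many pairwise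
   disjoint cycles [C_k]. Give the arcs of [C_k] weight close to
   [t (1 - eps_k)], and all other arcs a tiny weight such that the row sums
   remain below [t (1 - eps_k / 2)]. Then [lambda = t], the strict row sums make
   [M] transient, and [lambda_n >= t (1 - eps_k)] as soon as [n >= #|C_k|], with
   [eps_k] as small as desired. *)

Set Implicit Arguments.
Unset Strict Implicit.
Unset Printing Implicit Defensive.

Import numFieldNormedType.Exports.
Import Order.TTheory GRing.Theory Num.Theory.

Local Open Scope classical_set_scope.
Local Open Scope ring_scope.

(** * Collatz-Wielandt bounds for the spectral radius of a finite nonnegative matrix *)

(** At an index [i] maximizing [m = y i / x i], a positive [m] would give [t y_i <= (A y)_i <= m (A
    x)_i < m t x_i = t y_i]. *)
Lemma strict_subsolution_le0 (R : realType) n (A : 'M[R]_n)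
    (x y : 'I_n -> R) (t : R) :
    (forall i j, 0 <= A i j) -> (forall i, 0 < x i) ->
    (forall i, \sum_j A i j * x j < t * x i) ->
    (forall i, t * y i <= \sum_j A i j * y j) ->
  forall i, y i <= 0.
Proof.
move=> A0 x0 Ax Ay i0.
pose i := [arg max_(i > i0) (y i / x i)]%O.
have ymax j : y j <= (y i / x i) * x j.
  rewrite -ler_pdivrMr //; rewrite /i; case: arg_maxP => // k _; exact.
have [m0|m0] := leP (y i / x i) 0.
  by rewrite (le_trans (ymax i0)) // pmulr_lle0.
have : t * y i < t * y i.
  rewrite (le_lt_trans (Ay i)) // (@le_lt_trans _ _ (y i / x i * \sum_j A i j * x j)) //.
    rewrite mulr_sumr ler_sum // => j _.
    by rewrite mulrCA ler_wpM2l.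
  rewrite -ltr_pdivlMl // (lt_le_trans (Ax i)) //.
  rewrite le_eqVlt; apply/orP; left; apply/eqP.
  have xi : x i != 0 by rewrite gt_eqF.
  have yi : y i != 0 by apply: contraTneq m0 => ->; rewrite mul0r ltxx.
  by field; rewrite xi yi.
by rewrite ltxx.
Qed.

(** Eigenvectors are row vectors, so the moduli of [v] pair with [x] on the right:
    [|z| (|v| x) <= |v| A x <= c (|v| x)], where [|v| x > 0]. *)
Lemma normc_eigenvalue_le (R : realType) n (A : 'M[R]_n) (x : 'I_n -> R)
    (c : R) (z : R[i]) :
    (forall i j, 0 <= A i j) -> (forall i, 0 < x i) ->
    (forall i, \sum_j A i j * x j <= c * x i) ->
  eigenvalue (map_mx (real_complex R) A) z -> ComplexField.Normc.normc z <= c.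
Proof.
move=> A0 x0 Ax /eigenvalueP[v vA v0].
pose N := @ComplexField.Normc.normc R.
have NM a b : N (a * b) = N a * N b by exact: ComplexField.Normc.normcM.
have N0 a : 0 <= N a by case: a => a b; exact: sqrtr_ge0.
have ND a b : N (a + b) <= N a + N b.
  exact: (le_normcD a b).
have Nreal a : 0 <= a -> N (real_complex R a) = a.
  by move=> a0; rewrite /N /= expr0n addr0 sqrtr_sqr ger0_norm.
have Nsum (F : 'I_n -> R[i]) : N (\sum_i F i) <= \sum_i N (F i).
  elim/big_ind2 : _ => //; first by rewrite /N ComplexField.Normc.normc0.
  by move=> a b a' b' ? ?; rewrite (le_trans (ND _ _)) ?lerD.
have [j vj] : exists j, v 0 j != 0.
  apply/existsP; apply: contra_neqT v0; rewrite negb_exists => /forallP h.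
  by apply/rowP => j; rewrite mxE; apply/eqP; have := h j; rewrite negbK.
pose s := \sum_j N (v 0 j) * x j.
have s0 : 0 < s.
  rewrite /s (bigD1 j) //= ltr_wpDr //; first by rewrite sumr_ge0 // => i _; rewrite mulr_ge0 // ltW.
  rewrite mulr_gt0 // lt_neqAle N0 andbT eq_sym; apply: contra vj => /eqP.
  by move/ComplexField.Normc.eq0_normc ->.
rewrite -(ler_pM2r s0) /s mulr_sumr.
have h i : N z * (N (v 0 i) * x i) <= \sum_k N (v 0 k) * A k i * x i.
  rewrite mulrA -NM -mulr_suml ler_wpM2r ?(ltW (x0 _)) //.
  have := congr1 (fun w : 'rV_n => w 0 i) vA; rewrite !mxE => <-.
  rewrite (le_trans (Nsum _)) // ler_sum // => k _.
  by rewrite NM mxE Nreal.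
rewrite (le_trans (ler_sum _ (fun i _ => h i))) // exchange_big /= mulr_sumr ler_sum // => k _.
under eq_bigr do rewrite -mulrA.
by rewrite -mulr_sumr mulrCA ler_wpM2l.
Qed.

Lemma spectral_radius_le (R : realType) n (A : 'M[R]_n) (x : 'I_n -> R) (c : R) :
    0 <= c -> (forall i j, 0 <= A i j) -> (forall i, 0 < x i) ->
    (forall i, \sum_j A i j * x j <= c * x i) ->
  spectral_radius A <= c.
Proof.
move=> c0 A0 x0 Ax; rewrite /spectral_radius.
(* The set is empty when [n = 0]; its [sup] is then 0, whence the hypothesis [0 <= c]. *)
set S := (X in sup X); have [->|/set0P[r Sr]] := eqVneq S set0; first by rewrite sup0.
apply: ge_sup; first by exists r.
by move=> _ [z + <-]; exact: normc_eigenvalue_le.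
Qed.

Lemma eigenvalue_le_spectral_radius (R : realType) n (A : 'M[R]_n) (t : R) :
    (forall i j, 0 <= A i j) -> eigenvalue A t -> t <= spectral_radius A.
Proof.
move=> A0 At; apply: (@le_trans _ _ (ComplexField.Normc.normc (real_complex R t))).
  by rewrite /= expr0n addr0 sqrtr_sqr ler_norm.
apply: ub_le_sup; last first.
  exists (real_complex R t) => //=.
  by rewrite eigenvalue_root_char -map_char_poly fmorph_root -eigenvalue_root_char.
(* The supremum needs a bounded set: with the constant vector 1, the sum of all entries bounds every
   eigenvalue. *)
exists (\sum_i \sum_j A i j) => _ [z /= zA <-].
apply: (@normc_eigenvalue_le R n A (fun=> 1)) => // i.
under [in X in X <= _]eq_bigr do rewrite mulr1.
by rewrite /= mulr1 [leRHS](bigD1 i) //= lerDl sumr_ge0 // => k _; rewrite sumr_ge0.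
Qed.

Lemma horner_ge0_right (R : realType) (p : {poly R}) (a : R) :
  (forall t, a < t -> 0 <= p.[t]) -> 0 <= p.[a].
Proof.
move=> h; have pa := cvg_at_right_filter (@continuous_horner R p a).
by apply: (cvgr_to_ge pa); near=> t; apply: h; near: t; exact: nbhs_right_gt.
Unshelve. all: by end_near. Qed.

Lemma horner_char_poly_mx (R : comNzRingType) n (A : 'M[R]_n) (t : R) :
  map_mx (horner_eval t) (char_poly_mx A) = t%:M - A.
Proof.
apply/matrixP => k l; rewrite !mxE /horner_eval.
by rewrite hornerD hornerN hornerC hornerMn hornerX.
Qed.

(* The witness is the real eigenvalue [t0], the infimum of the [t] admitting a
   strict subsolution [A x < t x] with [x > 0]. For [t > t0] the resolvent
   [(t - A)^-1] is nonnegative; were [t0 - A] invertible, this would persist at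
   [t0], and [(t0 - A)^-1 1] would be a strict subsolution at the infimum of an
   open set. Multiplying the resolvent by the squared determinant makes it
   polynomial in [t]. *)
Lemma spectral_radius_ge (R : realType) n (A : 'M[R]_n) (y : 'I_n -> R) (r : R)
    (i0 : 'I_n) :
    (forall i j, 0 <= A i j) -> (forall i, 0 <= y i) -> 0 < y i0 ->
    (forall i, r * y i <= \sum_j A i j * y j) ->
  r <= spectral_radius A.
Proof.
move=> A0 y0 yi0 Ay.
pose T := [set t | exists2 x : 'I_n -> R, (forall i, 0 < x i) &
                     forall i, \sum_j A i j * x j < t * x i].
have T_up t t' : T t -> t < t' -> T t'.
  move=> [x x0 Ax] tt'; exists x => // i.
  by rewrite (lt_trans (Ax i)) // ltr_pM2r.
have T_lb : lbound T r.
  move=> t [x x0 Ax]; rewrite leNgt; apply/negP => tr.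
  suff : y i0 <= 0 by rewrite leNgt yi0.
  apply: (strict_subsolution_le0 A0 x0 Ax) => i.
  by rewrite (le_trans _ (Ay i)) // ler_wpM2r // ltW.
have T_neq0 : T !=set0.
  exists (\sum_i \sum_j A i j + 1), (fun=> 1) => // i.
  under [in X in X < _]eq_bigr do rewrite mulr1.
  rewrite mulr1 ltr_pwDr // [leRHS](bigD1 i) //= lerDl sumr_ge0 // => k _.
  by rewrite sumr_ge0.
pose t0 := inf T.
have t0_r : r <= t0 by exact: lb_le_inf.
have T_gt t : t0 < t -> T t.
  by move=> /inf_lt[]// t' Tt' t't; exact: T_up t't.
(* If [t0] were in [T], the largest ratio [m] of [A x] to [x] would be below [t0], and the midpoint
   of [m] and [t0] would lie in [T] under its infimum. *)
have T_t0 : ~ T t0.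
  move=> [x x0 Ax].
  pose i := [arg max_(i > i0) ((\sum_j A i j * x j) / x i)]%O.
  pose m := (\sum_j A i j * x j) / x i.
  have mP k : \sum_j A k j * x j <= m * x k.
    by rewrite -ler_pdivrMr // /m /i; case: arg_maxP => // l _; exact.
  have mt0 : m < t0 by rewrite ltr_pdivrMr.
  have : T ((m + t0) / 2).
    by exists x => // k; rewrite (le_lt_trans (mP k)) // ltr_pM2r // midf_lt.
  by move=> /(ge_inf (ex_intro _ r T_lb)); rewrite leNgt midf_lt.
pose q i := \det (char_poly_mx A) * \sum_j \adj (char_poly_mx A) i j.
have qE t i : (q i).[t] =
    \det (t%:M - A) * \sum_j \adj (t%:M - A) i j.
  rewrite -(horner_char_poly_mx A t) det_map_mx -map_mx_adj /q hornerM; congr (_ * _).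
  by rewrite horner_sum; apply: eq_bigr => j _; rewrite [RHS]mxE.
have resolventE t i : \sum_j A i j * (q j).[t] =
    t * (q i).[t] - (\det (t%:M - A)) ^+ 2.
  have : \sum_j (t%:M - A) i j * (q j).[t] = (\det (t%:M - A)) ^+ 2.
    have adjE k : \sum_j (t%:M - A) i j * \adj (t%:M - A) j k =
        \det (t%:M - A) *+ (i == k).
      by have := congr1 (fun B : 'M[R]_n => B i k) (mul_mx_adj (t%:M - A)); rewrite !mxE.
    under eq_bigr do rewrite qE mulrCA mulr_sumr.
    rewrite -mulr_sumr exchange_big /= expr2; congr (_ * _).
    under eq_bigr do rewrite adjE.
    rewrite (bigD1 i) //= eqxx big1 ?addr0 // => k; rewrite eq_sym => /negPf->.
    by [].
  under eq_bigr do rewrite !mxE mulrBl.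
  rewrite sumrB (bigD1 i) //= eqxx mulr1n big1 ?addr0; last first.
    by move=> j; rewrite eq_sym => /negPf ->; rewrite mulr0n mul0r.
  by move=> <-; rewrite opprB addrC subrK.
(* For [t > t0], [A q = t q - det^2] shows that [y = - q] satisfies [t y <= A y]; comparison with a
   strict subsolution gives [- q <= 0], and [t] then tends to [t0]. *)
have q_ge0 i : 0 <= (q i).[t0].
  apply: horner_ge0_right => t /T_gt[x x0 Ax].
  rewrite -oppr_le0.
  apply: (strict_subsolution_le0 (y := fun i => - (q i).[t]) A0 x0 Ax) => k.
  under eq_bigr do rewrite mulrN.
  by rewrite sumrN resolventE mulrN lerN2 lerBlDr lerDl sqr_ge0.
have [d0|d0] := eqVneq (\det (t0%:M - A)) 0.
  apply: (le_trans t0_r); apply: eigenvalue_le_spectral_radius => //.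
  rewrite eigenvalue_root_char /root.
  apply/eqP; rewrite -[LHS]/(horner_eval t0 (\det (char_poly_mx A))) -det_map_mx.
  rewrite -[RHS]d0; congr (\det _); exact: horner_char_poly_mx.
exfalso; apply: T_t0; exists (fun i => (q i).[t0]) => i; last first.
  by rewrite resolventE ltrBlDr ltrDl exprn_even_gt0.
(* [t0 q = A q + det^2 > 0] excludes [q i = 0], whatever the sign of [t0]. *)
have : 0 < t0 * (q i).[t0].
  rewrite -[ltRHS](subrK ((\det (t0%:M - A)) ^+ 2)) -resolventE.
  rewrite ltr_wpDl ?exprn_even_gt0 // sumr_ge0 // => j _.
  exact: mulr_ge0.
by have := q_ge0 i; rewrite le_eqVlt => /predU1P[<-|//]; rewrite mulr0 ltxx.
Qed.

(** * Cycles of a strong digraph and finite index sets *)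

Lemma ucycle_cons_path (T : eqType) (e : rel T) (v w : T) (p : seq T) :
  e v w -> path e w p -> last w p = v -> uniq (w :: p) -> ucycle e (w :: p).
Proof. by move=> vw wp pv u; rewrite /ucycle /= rcons_path wp pv vw. Qed.

Lemma strong_dicycle (V : countType) (E : rel V) :
  strong E -> exists c, dicycle E c.
Proof.
move=> [[v _] conn out]; have [w vw] := out v.
have [wv|/conn[p [wp pv u]]] := eqVneq w v.
  by exists [:: w]; split=> //; apply: (ucycle_cons_path vw).
by exists (w :: p); split=> //; exact: (ucycle_cons_path vw).
Qed.

Lemma exists_pos_lt_seq (R : realFieldType) (T : eqType) (F : T -> R) (s : seq T) :
  (forall x, x \in s -> 0 < F x) ->
  exists2 d : R, 0 < d & forall x, x \in s -> d < F x.
Proof.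
elim: s => [|y s IH] F0; first by exists 1.
have [|d d0 dF] := IH; first by move=> x xs; apply: F0; rewrite inE xs orbT.
have Fy : 0 < F y by apply: F0; rewrite inE eqxx.
exists (Num.min d (F y / 2)); first by rewrite lt_min d0 divr_gt0.
move=> x; rewrite inE gt_min => /predU1P[->|/dF ->//].
by rewrite orbC ltr_pdivrMr // ltr_pMr // ltrDl ltr01.
Qed.

(** Pads a list to an index set of prescribed order, so that a cycle contributes to [lambda_n] for
    every [n] at least its length. *)
Lemma infinite_injective_cover (V : choiceType) (s : seq V) (n : nat) :
    infinite_set [set: V] -> uniq s -> (size s <= n)%N ->
  exists2 f : 'I_n -> V, injective f & {subset s <= codom f}.
Proof.
move=> infV us sn.
have [t [ut st tn]] : exists t : seq V, [/\ uniq t, {subset s <= t} & size t == n].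
  rewrite -(subnKC sn); elim: (n - size s)%N => [|k [t [ut st /eqP tk]]].
    by exists s; split=> //; rewrite addn0.
  have [v [_ vt]] := infinite_setN0 (infinite_setD infV (finite_seq t)).
  exists (v :: t); split; first by rewrite /= ut andbT; apply/negP.
  - by move=> x /st xt; rewrite inE xt orbT.
  - by rewrite /= tk addnS.
exists (tnth (Tuple tn)); first exact/tuple_uniqP.
by move=> x /st xt; have /tnthP[i ->] : x \in Tuple tn by []; exact: codom_f.
Qed.

(** * Truncated spectral radii and the Green function of an infinite nonnegative matrix *)

Section Lambda.
Variables (R : realType) (V : countType) (M : V -> V -> R).
Hypothesis M0 : nonneg_mat M.

Lemma lambda_n_le_lambda n : (lambda_n M n <= lambda M)%E.
Proof. by apply: ereal_sup_ubound; exists n. Qed.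

(** The indicator of [c] serves as test vector: the row of each vertex of [c] meets its successor
    with weight at least [r]. *)
Lemma lambda_n_ge_cycle n (f : 'I_n -> V) (c : seq V) (r : R) :
    injective f -> c != [::] -> {subset c <= codom f} ->
    (forall v, v \in c -> r <= M v (next c v)) ->
  (r%:E <= lambda_n M n)%E.
Proof.
move=> finj c0 cf rM.
apply: (@le_trans _ _ (spectral_radius (principal M f))%:E); last first.
  by apply: ereal_sup_ubound; exists f.
have [v vc] : exists v, v \in c.
  by case: c c0 {cf rM} => // v c _; exists v; rewrite inE eqxx.
have /codomP[i0 vE] := cf _ vc.
rewrite lee_fin; apply: (@spectral_radius_ge _ _ _ (fun i => (f i \in c)%:R) _ i0).
- by move=> i j; rewrite mxE.
- by move=> i; rewrite ler0n.
- by rewrite -vE vc ltr01.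
move=> i; have [fic|fic] := boolP (f i \in c); last first.
  by rewrite mulr0 sumr_ge0 // => j _; rewrite mulr_ge0 ?ler0n // mxE.
have nc : next c (f i) \in c by rewrite mem_next.
have /codomP[j fj] := cf _ nc.
rewrite mulr1 (bigD1 j) //= -fj nc mulr1 mxE -fj (le_trans (rM _ fic)) //.
by rewrite lerDl sumr_ge0 // => k _; rewrite mulr_ge0 ?ler0n // mxE.
Qed.

(** Infinitude of [V] provides a submatrix of order [n], so that the supremum is not the default
    [-oo]. *)
Lemma lambda_n_ge0 n : infinite_set [set: V] -> (0 < n)%N -> (0 <= lambda_n M n)%E.
Proof.
move=> infV n0; have [f finj _] := @infinite_injective_cover V [::] n infV isT isT.
apply: (@le_trans _ _ (spectral_radius (principal M f))%:E); last first.
  by apply: ereal_sup_ubound; exists f.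
rewrite lee_fin.
apply: (@spectral_radius_ge _ _ _ (fun=> 1) _ (Ordinal n0)) => //.
  by move=> i j; rewrite mxE.
by move=> i; rewrite mul0r sumr_ge0 // => j _; rewrite mulr_ge0 // mxE.
Qed.

Lemma lambda_gt0 (E : rel V) : digraph_of M =2 E -> strong E -> (0 < lambda M)%E.
Proof.
move=> ME /strong_dicycle[c [c0 /andP[cyc uc]]].
have [v vc|r r0 rM] := @exists_pos_lt_seq R V (fun v => M v (next c v)) c.
  by rewrite lt_neqAle M0 andbT eq_sym; have := next_cycle cyc vc; rewrite -ME.
apply: (@lt_le_trans _ _ r%:E); first by rewrite lte_fin.
apply: le_trans (lambda_n_le_lambda (size c)).
apply: (@lambda_n_ge_cycle _ (tnth (in_tuple c)) c).
- exact/tuple_uniqP.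
- exact/eqP.
- by move=> x; rewrite -[c]/(val (in_tuple c)) => /tnthP[i ->]; exact: codom_f.
- by move=> v /rM/ltW.
Qed.

Lemma mat_pow_ge0 p v w : (0 <= mat_pow M p v w)%E.
Proof.
elim: p v => [|p IH] v /=; first by rewrite lee_fin ler0n.
by apply: esum_ge0 => u _; rewrite mule_ge0 // lee_fin.
Qed.

Lemma sum_le_mat_powS n (f : 'I_n -> V) p v w : injective f ->
  (\sum_j (M v (f j))%:E * mat_pow M p (f j) w <= mat_pow M p.+1 v w)%E.
Proof.
move=> finj /=; apply: esum_ge.
exists [set` [seq f j | j <- enum 'I_n]].
  by split; [exact: finite_seq | exact: subsetT].
rewrite -fsbig_seq; first by rewrite big_map big_enum.
by rewrite map_inj_uniq ?enum_uniq.
Qed.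

Lemma mat_pow_path_gt0 p v w :
  path (digraph_of M) v p -> last v p = w -> (0 < mat_pow M (size p) v w)%E.
Proof.
elim: p v => [|u p IH] v /=; first by move=> _ ->; rewrite eqxx lte_fin ltr01.
move=> /andP[vu up] pw.
apply: lt_le_trans (@sum_le_mat_powS 1 (fun=> u) (size p) v w _); last first.
  by move=> i j _; rewrite !ord1.
rewrite big_ord1 mule_gt0 ?IH // lte_fin.
by rewrite lt_neqAle M0 andbT eq_sym.
Qed.

(** The Neumann series of [(1 - M / l)^-1]; transience is its entrywise finiteness at
    [l = lambda M]. *)
Definition green (l : R) v w : \bar R :=
  (\sum_(0 <= p <oo) (mat_pow M p v w * (l ^- p)%:E))%E.

Lemma green_term_ge0 l p v w : 0 < l -> (0 <= mat_pow M p v w * (l ^- p)%:E)%E.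
Proof.
move=> l0; rewrite mule_ge0 ?mat_pow_ge0 // lee_fin invr_ge0 exprn_ge0 //.
exact: ltW.
Qed.

Lemma green_gt0 (E : rel V) l v w :
  digraph_of M =2 E -> strong E -> 0 < l -> (0 < green l v w)%E.
Proof.
move=> ME [_ conn _] l0.
have [p vp pw] : exists2 p, path (digraph_of M) v p & last v p = w.
  have [->|/conn[p [vp pw _]]] := eqVneq v w; first by exists [::].
  by exists p; rewrite // (eq_path ME).
have t0 i : (0 <= i)%N -> true -> (0 <= mat_pow M i v w * (l ^- i)%:E)%E.
  by move=> _ _; exact: green_term_ge0.
apply: lt_le_trans (nneseries_lim_ge (size p).+1 t0).
rewrite big_nat_recr //=.
apply: (@lt_le_trans _ _ (mat_pow M (size p) v w * (l ^- size p)%:E)%E).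
  by rewrite mule_gt0 ?mat_pow_path_gt0 // lte_fin invr_gt0 exprn_gt0.
by rewrite leeDr // sume_ge0 // => i _; exact: t0.
Qed.

(** Splitting off the term [p = 0] gives [G = 1 + (M / l) G]; keeping only finitely many columns of
    [M] leaves an inequality. *)
Lemma green_superharmonic n (f : 'I_n -> V) l v w : injective f -> 0 < l ->
  ((v == w)%:R%:E + \sum_j (M v (f j) / l)%:E * green l (f j) w <= green l v w)%E.
Proof.
move=> finj l0; rewrite [leRHS]/green nneseries_recl //; last first.
  by move=> k _; exact: green_term_ge0.
rewrite /= expr0 invr1 mule1 leeD2l // -(nneseries_addn 1); last first.
  by move=> k; exact: green_term_ge0.
have Ml0 j : 0 <= M v (f j) / l by rewrite divr_ge0 // ltW.
under eq_bigr => j _.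
  rewrite -nneseriesZl; last by move=> p _; exact: green_term_ge0.
  over.
rewrite -nneseries_sum; last first.
  by move=> j p _; rewrite mule_ge0 ?lee_fin ?green_term_ge0.
apply: lee_nneseries => p *.
  by apply: sume_ge0 => j _; rewrite mule_ge0 ?lee_fin ?green_term_ge0.
rewrite addn1; apply: le_trans (lee_wpmul2r _ (sum_le_mat_powS p v w finj)); last first.
  by rewrite lee_fin invr_ge0 exprn_ge0 // ltW.
rewrite ge0_sume_distrl; last first.
  by move=> j _; rewrite mule_ge0 ?lee_fin ?mat_pow_ge0.
apply: lee_sum => j _; rewrite exprS invfM !EFinM -!muleA.
by rewrite [in leRHS](muleCA (mat_pow _ _ _ _)).
Qed.
End Lambda.

(** * A finite cycle transversal forces a gap of order at least [1 / n] *)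

Lemma bernoulli_le (R : realDomainType) (a : R) (n : nat) :
  0 <= a <= 1 -> 1 - n%:R * a <= (1 - a) ^+ n.
Proof.
move=> /andP[a0 a1]; elim: n => [|n IH]; first by rewrite mul0r subr0 expr0.
rewrite exprS; have a1' : 0 <= 1 - a by rewrite subr_ge0.
apply: le_trans (ler_wpM2l a1' IH).
have := mulr_ge0 (ler0n R n) (mulr_ge0 a0 a0).
rewrite -natr1; lra.
Qed.

Section AcyclicHeight.
Variables (n : nat) (e : rel 'I_n).

Definition height i := #|connect e i|.

(** Whatever [j] reaches, [i] reaches too, and acyclicity keeps [i] itself out of the reach of
    [j]. *)
Lemma height_lt i j : (forall c, c != [::] -> ~ ucycle e c) -> e i j ->
  (height j < height i)%N.
Proof.
move=> acyclic ij; apply: proper_card; apply/properP; split.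
  apply/fintype.subsetP => k; rewrite !inE; apply: connect_trans; exact: connect1.
exists i; rewrite !inE //; apply/negP => /connectP[p jp].
case/shortenP: jp => p' jp' u _ iE.
exact: (acyclic (j :: p') isT (ucycle_cons_path ij jp' (esym iE) u)).
Qed.

End AcyclicHeight.

Lemma ucycle_map (T T' : eqType) (h : T -> T') (e : rel T') (c : seq T) :
  injective h -> ucycle (relpre h e) c -> ucycle e (map h c).
Proof.
move=> hinj /andP[cyc u]; rewrite /ucycle map_inj_uniq // u andbT.
by case: c cyc {u} => //= x p; rewrite -map_rcons path_map.
Qed.

(* With [h i] the number of vertices that [i] reaches outside [S], the vector
   [g * q ^ (n - h)] is a subsolution: outside [S] each arc lowers [h], which
   gains a factor [q], and on [S] the unit defect of [g] pays for the
   [n + 1] factors [q] by Bernoulli's inequality. *)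
Lemma spectral_radius_le_transversal (R : realType) (V : countType)
    (M : V -> V -> R) (S : set V) (g : V -> R) (l U : R) n (f : 'I_n -> V) :
    nonneg_mat M -> cycle_transversal (digraph_of M) S ->
    0 < l -> 1 <= U -> (forall v, 0 < g v) -> (forall s, s \in S -> g s <= U) ->
    injective f -> (0 < n)%N ->
    (forall v, \sum_j M v (f j) * g (f j) <= l * (g v - (v \in S)%:R)) ->
  spectral_radius (principal M f) <= l * (1 - (U * n.+1%:R)^-1).
Proof.
move=> M0 tS l0 U1 g0 gU finj n0 Mg.
set a := (U * n.+1%:R)^-1; set q := 1 - a.
have U0 : 0 < U by rewrite (lt_le_trans ltr01).
have a0 : 0 < a by rewrite invr_gt0 mulr_gt0 ?ltr0n.
have a1 : a < 1.
  rewrite invf_lt1 ?mulr_gt0 ?ltr0n //.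
  by rewrite (lt_le_trans _ (ler_peMl _ U1)) ?ltr1n ?ler0n.
have q0 : 0 < q by rewrite subr_gt0.
have q1 : q <= 1 by rewrite gerBl ltW.
pose e := relpre f (delete (digraph_of M) S).
have acyclic c : c != [::] -> ~ ucycle e c.
  move=> /eqP c0 /(ucycle_map finj) fc; apply: (tS (map f c)).
  by split=> //; case: c c0 {fc}.
(* [height] counts the vertex itself, hence is positive, so the value 0 on [S] makes arcs into [S]
   lower [h] as well. *)
pose h i := if f i \in S then 0%N else height e i.
have hn i : (h i <= n)%N.
  by rewrite /h; case: ifP => // _; rewrite -[leqRHS]card_ord max_card.
have h_lt i j : f i \notin S -> M (f i) (f j) != 0 -> (h j < h i)%N.
  move=> iS Mij; rewrite /h (negPf iS); case: ifPn => jS.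
    by apply/card_gt0P; exists i; rewrite inE.
  by apply: height_lt => //; apply/and3P; split.
have lq0 : 0 <= l * q by rewrite mulr_ge0 // ltW.
apply: (@spectral_radius_le _ _ _ (fun i => g (f i) * q ^+ (n - h i))) => //.
- by move=> i j; rewrite mxE.
- by move=> i; rewrite mulr_gt0 ?exprn_gt0.
move=> i; under eq_bigr do rewrite mxE.
have [iS|iS] := boolP (f i \in S).
  apply: (@le_trans _ _ (\sum_j M (f i) (f j) * g (f j))).
    apply: ler_sum => j _; apply: ler_wpM2l => //.
    by rewrite ler_piMr ?(ltW (g0 _)) // exprn_ile1 // ltW.
  rewrite (le_trans (Mg _)) // iS /h iS subn0 -mulrA ler_pM2l // mulrCA -exprS.
  (* On [S] the damping is [q ^ n], and the target factor [l * q] adds one more [q]: hence [n.+1] in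
     [a]. *)
  have aU : n.+1%:R * a = U^-1.
    by rewrite /a invfM mulrCA divff ?pnatr_eq0 // mulr1.
  have : 1 - U^-1 <= q ^+ n.+1 by rewrite -aU bernoulli_le // !ltW.
  move=> /(ler_wpM2l (ltW (g0 (f i)))); apply: le_trans.
  by rewrite mulrBr mulr1 lerB // ler_pdivrMr // mul1r gU.
apply: (@le_trans _ _ (\sum_j M (f i) (f j) * g (f j) * (q * q ^+ (n - h i)))).
  apply: ler_sum => j _; rewrite mulrA.
  have [->|/(h_lt _ _ iS) hji] := eqVneq (M (f i) (f j)) 0; first by rewrite !mul0r.
  rewrite ler_wpM2l ?mulr_ge0 ?(ltW (g0 _)) // -exprS.
  apply: ler_wiXn2l => //; first exact: ltW.
  by apply: ltn_sub2l => //; exact: leq_trans hji (hn i).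
rewrite -mulr_suml; have := Mg (f i); rewrite (negPf iS) subr0 => Mgi.
rewrite (le_trans (ler_wpM2r _ Mgi)) ?mulr_ge0 ?exprn_ge0 ?(ltW q0) //.
by rewrite mulrACA.
Qed.

Lemma transversal_inverse_linear_gap (R : realType) (V : countType) (E : rel V)
    (S : set V) :
  strong E -> finite_set S -> cycle_transversal E S -> inverse_linear_gap R E.
Proof.
move=> strongE /finite_seqP[s SE] tS M [M0 ME lfin tr].
have [L L0 LE] : exists2 L, 0 < L & lambda M = L%:E.
  have := lambda_gt0 M0 ME strongE; case: (lambda M) lfin => // L _.
  by rewrite lte_fin; exists L.
have tS' : cycle_transversal (digraph_of M) S.
  move=> c [c0 cyc]; apply: (tS c); split=> //; move: cyc; rewrite /ucycle.
  have del : delete (digraph_of M) S =2 delete E S.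
    by move=> v w; rewrite /delete /= -ME.
  by rewrite (eq_cycle del).
have [[v0 _] _ _] := strongE.
(* The arguments are swapped: [G w] is column [w] of the Green function, real valued because [M] is
   transient. *)
pose G w v := fine (green M L v w).
have GE w v : green M L v w = (G w v)%:E.
  rewrite fineK // ge0_fin_numE ?ltW ?(green_gt0 M0 _ _ ME) //.
  by have := tr v w; rewrite LE.
have G0 w v : 0 < G w v.
  by rewrite -lte_fin -GE (green_gt0 M0 _ _ ME).
have GM n (f : 'I_n -> V) w v : injective f ->
    \sum_j M v (f j) * G w (f j) <= L * (G w v - (v == w)%:R).
  move=> finj; have := green_superharmonic M0 v w finj L0.
  rewrite GE; under eq_bigr do rewrite GE -EFinM.
  rewrite sumEFin -EFinD lee_fin addrC -lerBrDr.
  rewrite -(ler_pM2l L0); apply: le_trans; rewrite mulr_sumr ler_sum // => j _.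
  by rewrite mulrA mulrCA divff ?gt_eqF // mulr1.
(* [v0] is added so that [g] is positive even when [s] is empty *)
pose g v := \sum_(w <- v0 :: s) G w v.
have g0 v : 0 < g v.
  by rewrite /g big_cons ltr_wpDr // sumr_ge0 // => w _; exact: ltW.
pose U := 1 + \sum_(w <- s) g w.
have U1 : 1 <= U by rewrite lerDl sumr_ge0 // => w _; exact: ltW.
have gU v : v \in S -> g v <= U.
  rewrite SE mem_setE => vs; rewrite /U (big_rem v) //= addrCA lerDl addr_ge0 //.
  by rewrite sumr_ge0 // => w _; exact: ltW.
have gM n (f : 'I_n -> V) v : injective f ->
    \sum_j M v (f j) * g (f j) <= L * (g v - (v \in S)%:R).
  move=> finj; under eq_bigr do rewrite mulr_sumr.
  rewrite exchange_big /=.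
  apply: (@le_trans _ _ (\sum_(w <- v0 :: s) L * (G w v - (v == w)%:R))).
    by apply: ler_sum => w _; exact: GM.
  rewrite -mulr_sumr sumrB ler_pM2l // lerD2l lerN2.
  rewrite big_cons ler_wpDl ?ler0n // SE mem_setE.
  have [vs|_] := boolP (v \in s); last by rewrite sumr_ge0 // => w _; rewrite ler0n.
  by rewrite (big_rem v) //= eqxx lerDl sumr_ge0 // => w _; rewrite ler0n.
have U0 : 0 < U by rewrite (lt_le_trans ltr01).
(* The scaled gap is at least [L / U * (n / (n + 1)) >= L / (2 * U)]; the 3 makes the inequality
   strict at [n = 1]. *)
exists (L / (3 * U)); first by rewrite divr_gt0 ?mulr_gt0.
move=> n n0.
have lam : (lambda_n M n <= (L * (1 - (U * n.+1%:R)^-1))%:E)%E.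
  apply: ge_ereal_sup => _ [f finj <-]; rewrite lee_fin.
  by apply: (spectral_radius_le_transversal (S := S) (g := g)) => // v; exact: gM.
apply: (@lt_le_trans _ _ (n%:R%:E * (L%:E - (L * (1 - (U * n.+1%:R)^-1))%:E))%E); last first.
  by rewrite LE lee_wpmul2l ?lee_fin ?ler0n // leeB.
rewrite -EFinB -EFinM lte_fin.
have n1 : 1 <= n%:R :> R by rewrite ler1n.
have -> : n%:R * (L - L * (1 - (U * n.+1%:R)^-1)) = L / U * (n%:R / n.+1%:R).
  by rewrite invfM; set b := n.+1%:R^-1; ring.
have -> : L / (3 * U) = L / U * 3^-1 by rewrite invfM mulrA mulrAC.
rewrite ltr_pM2l ?divr_gt0 // ltr_pdivlMr ?ltr0n // -(natr1 n); lra.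
Qed.

(** * Disjoint cycles and summable weights *)

Lemma delete_dicycle (V : countType) (E : rel V) (S : set V) (c : seq V) :
  dicycle (delete E S) c -> dicycle E c /\ forall v, v \in c -> v \notin S.
Proof.
move=> [c0 /andP[cyc u]]; split; last by move=> v /(next_cycle cyc)/and3P[].
split=> //; apply/andP; split=> //; apply: sub_cycle cyc.
by move=> v w /and3P[].
Qed.

(** Greedy choice: the vertices of the cycles already chosen form a finite set, which is not a
    transversal, so some cycle avoids them. *)
Lemma infinite_disjoint_dicycles (V : countType) (E : rel V) :
    (forall S : set V, finite_set S -> ~ cycle_transversal E S) ->
  exists C : nat -> seq V, (forall k, dicycle E (C k)) /\
    forall j k v, v \in C j -> v \in C k -> j = k.
Proof.
move=> noS.
have /choice[nx nxP] (L : seq V) : exists c : seq V,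
    dicycle E c /\ forall v, v \in c -> v \notin L.
  have /existsNP[c /contrapT /delete_dicycle[Ec cL]] := noS _ (finite_seq L).
  by exists c; split=> // v /cL; rewrite mem_setE.
pose D k := iter k (fun L => nx L ++ L) [::].
have DS j k v : (j < k)%N -> v \in nx (D j) -> v \in D k.
  elim: k => // k IH; rewrite ltnS leq_eqVlt => /predU1P[->|/IH{}IH] vj.
    by rewrite /D iterS mem_cat vj.
  by rewrite /D iterS mem_cat IH ?orbT.
exists (nx \o D); split=> [k|j k v /= vj vk]; first exact: (nxP _).1.
case: (ltngtP j k) => // jk.
  by have := (nxP _).2 _ vk; rewrite (DS _ _ _ jk vj).
by have := (nxP _).2 _ vj; rewrite (DS _ _ _ jk vk).
Qed.

(** Distinct codes select distinct terms of [1/2 + 1/4 + ... = 1]. Such weights allow infinitely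
    many arcs out of a vertex with a bounded row sum. *)
Lemma sum_half_pow_pickle_le1 (R : realFieldType) (T : countType) (r : seq T) :
  uniq r -> \sum_(x <- r) 2^-1 ^+ (pickle x).+1 <= 1 :> R.
Proof.
move=> ur; rewrite -(big_map pickle xpredT (fun k => 2^-1 ^+ k.+1)).
set s := map pickle r.
have us : uniq s by rewrite map_inj_uniq //; exact: (pcan_inj pickleK).
pose N := (\max_(k <- s) k).+1.
have sN k : k \in s -> (k < N)%N by move=> ks; rewrite ltnS; exact: (leq_bigmax_seq (F := fun k => k)).
have half0 k : 0 <= 2^-1 ^+ k :> R by rewrite exprn_ge0 // invr_ge0.
have sE : perm_eq s [seq k <- iota 0 N | k \in s].
  apply: uniq_perm => // [|k]; first by rewrite filter_uniq // iota_uniq.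
  by rewrite mem_filter mem_iota add0n /=; case: (boolP (k \in s)) => // /sN ->.
rewrite (perm_big _ sE) big_filter big_mkcond.
apply: (@le_trans _ _ (\sum_(k <- iota 0 N) 2^-1 ^+ k.+1)).
  by apply: ler_sum => k _; case: ifP.
suff -> : \sum_(k <- iota 0 N) 2^-1 ^+ k.+1 = 1 - 2^-1 ^+ N :> R by rewrite gerBl.
elim: N {sN sE} => [|N IH]; first by rewrite big_nil expr0 subrr.
rewrite -addn1 iotaD big_cat IH big_seq1 /= add0n addn1 exprS; by field.
Qed.

Lemma ge0_esumZr (R : realType) (T : choiceType) (a : T -> \bar R) (c : R) :
    (forall u, 0 <= a u)%E -> 0 <= c ->
  (\esum_(u in [set: T]) (a u * c%:E) = (\esum_(u in [set: T]) a u) * c%:E)%E.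
Proof.
move=> a0 c0; rewrite muleC /esum -ereal_supZl //; last first.
  by apply/set0P; exists 0%E, set0; [exact: fsets_set0 | rewrite fsbig_set0].
congr ereal_sup; rewrite image_comp; apply: eq_imagel => A [Afin _] /=.
rewrite !fsbig_finite // ge0_sume_distrr //; first by apply: eq_bigr => u _; rewrite muleC.
Qed.

(** * Transience from strict row sums *)

Section StrictSubstochastic.
Variables (R : realType) (V : countType) (M : V -> V -> R) (t : R).
Variable d : V -> R.
Hypotheses (M0 : nonneg_mat M) (t0 : 0 < t) (d0 : forall v, 0 < d v).
Hypothesis row_sum : forall v (r : seq V), uniq r ->
  \sum_(w <- r) M v w <= t * (1 - d v).

Lemma lambda_le_row_sum : (lambda M <= t%:E)%E.
Proof.
apply: ge_ereal_sup => _ [n _ <-]; apply: ge_ereal_sup => _ [f finj <-].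
rewrite lee_fin; apply: (@spectral_radius_le _ _ _ (fun=> 1)) => //.
- exact: ltW.
- by move=> i j; rewrite mxE.
move=> i; rewrite mulr1.
have uf : uniq [seq f j | j <- enum 'I_n] by rewrite map_inj_uniq ?enum_uniq.
apply: (@le_trans _ _ (t * (1 - d (f i)))).
  apply: le_trans (row_sum (f i) uf); rewrite big_map big_enum /=.
  by rewrite le_eqVlt; apply/orP; left; apply/eqP; apply: eq_bigr => j _; rewrite mxE mulr1.
by rewrite ler_piMr ?ltW // gtrBl.
Qed.

(** [M / t] is a walk killed at [v] with probability at least [d v], so it visits [w] at most
    [1 / d w] times on average, from any start. Induction on the first step closes since
    [1 + (1 - d w) / d w = 1 / d w]. *)
Lemma partial_green_le N v w :
  (\sum_(0 <= p < N) mat_pow M p v w * (t ^- p)%:E <= (d w)^-1%:E)%E.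
Proof.
have dw : 0 < (d w)^-1 by rewrite invr_gt0.
elim: N v => [|N IH] v; first by rewrite big_geq // lee_fin ltW.
rewrite big_nat_recl //= expr0 invr1 mule1.
suff tail : (\sum_(0 <= p < N) mat_pow M p.+1 v w * (t ^- p.+1)%:E
             <= ((1 - d v) * (d w)^-1)%:E)%E.
  apply: le_trans (leeD2l _ tail) _; rewrite -EFinD lee_fin mulrBl mul1r.
  have [->|_] := eqVneq v w; first by rewrite divff ?gt_eqF // addrC subrK.
  by rewrite add0r gerBl divr_ge0 // ltW.
have c0 p : 0 <= t ^- p by rewrite invr_ge0 exprn_ge0 // ltW.
have a0 p u : (0 <= (M v u)%:E * mat_pow M p u w)%E.
  by rewrite mule_ge0 ?lee_fin ?mat_pow_ge0.
rewrite /=; under eq_bigr do rewrite -ge0_esumZr //.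
(* Exchanging the sums over [p] and [u] leaves finite sets of first steps [u], to which [IH] and
   [row_sum] apply. *)
rewrite -esum_sum; last by move=> u p _ _; rewrite mule_ge0 // lee_fin.
apply: ge_ereal_sup => _ [A [Afin _] <-]; rewrite fsbig_finite //=.
apply: (@le_trans _ _ (\sum_(u <- finmap.enum_fset (fset_set A)) (M v u / t * (d w)^-1)%:E)%E).
  apply: lee_sum => u _.
  have -> : (\sum_(0 <= p < N) (M v u)%:E * mat_pow M p u w * (t ^- p.+1)%:E =
      (M v u / t)%:E * \sum_(0 <= p < N) mat_pow M p u w * (t ^- p)%:E)%E.
    rewrite ge0_sume_distrr; last first.
      by move=> p _; rewrite mule_ge0 ?mat_pow_ge0 ?lee_fin.
    apply: eq_bigr => p _; rewrite exprS invfM !EFinM -!muleA.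
    by rewrite (muleCA (mat_pow _ _ _ _)).
  by rewrite [leRHS]EFinM lee_wpmul2l ?lee_fin ?divr_ge0 // ltW.
rewrite sumEFin lee_fin -mulr_suml ler_pM2r // -mulr_suml ler_pdivrMr //.
by rewrite mulrC row_sum // finmap.fset_uniq.
Qed.

Lemma transient_row_sum : lambda M = t%:E -> transient M.
Proof.
move=> lE v w; rewrite lE /=; apply: le_lt_trans (ltry (d w)^-1).
apply: lime_le.
  by apply: is_cvg_nneseries => p _ _; exact: green_term_ge0.
by near=> N; exact: partial_green_le.
Unshelve. all: by end_near. Qed.

End StrictSubstochastic.

(** * Construction of a rapidly approximated transient matrix *)

Lemma no_transversal_arbitrarily_fast (R : realType) (V : countType) (E : rel V) :
    (forall S : set V, finite_set S -> ~ cycle_transversal E S) ->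
  arbitrarily_fast_approx R E.
Proof.
move=> noS g g0.
have infV : infinite_set [set: V].
  move=> /noS; apply=> c /delete_dicycle[[c0 _] cS].
  by case: c c0 cS => // v c _ /(_ v (mem_head _ _)); rewrite in_setT.
have [C [cycC disjC]] := infinite_disjoint_dicycles noS.
(* For orders too small for [C 0] the only lower bound used is [0 <= lambda_n], so [t] itself must
   be below [g] there. *)
have [t t0 tg] := @exists_pos_lt_seq R nat g (iota 0 (size (C 0%N))) (fun m _ => g0 m).
(* [C k] has to serve orders up to [size (C k.+1)]. Order 0 is always in the list, which yields the
   bound [1 / (k + 1)] forcing [eps] to 0. *)
have /choice[eps epsP] k : exists eps : R, [/\ 0 < eps, eps < k.+1%:R^-1 &
    forall m, (m < (size (C k.+1)).+1)%N -> t * eps < g m].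
  have [m _|eps eps0 epsF] := @exists_pos_lt_seq R nat
    (fun m => Num.min (g m / t) k.+1%:R^-1) (iota 0 (size (C k.+1)).+1).
    by rewrite lt_min divr_gt0 // invr_gt0 ltr0n.
  exists eps; split=> //.
    by have := epsF 0%N; rewrite mem_iota lt_min => /(_ isT)/andP[].
  move=> m mC; have := epsF m; rewrite mem_iota lt_min => /(_ mC)/andP[+ _].
  by rewrite ltr_pdivlMr // mulrC.
have eps0 k : 0 < eps k by case: (epsP k).
have eps1 k : eps k < 1.
  have [_ + _] := epsP k; move/lt_le_trans; apply.
  by rewrite invf_le1 ?ltr0n // ler1n.
(* By disjointness at most one cycle passes through [v]; off all cycles the index defaults to 0. *)
have /choice[idx idxP] v : exists k, forall j, v \in C j -> j = k.
  have [[k vk]|nok] := pselect (exists k, v \in C k).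
    by exists k => j vj; exact: disjC vj vk.
  by exists 0%N => j vj; case: nok; exists j.
pose onC v w := (v \in C (idx v)) && (w == next (C (idx v)) v).
(* The cycle arc takes [1 - eps] and the geometric part adds at most [eps / 2] in total, which
   leaves a defect of at least [eps / 2] in each row. *)
pose W v w : R := (onC v w)%:R * (1 - eps (idx v)) +
  eps (idx v) / 2 * 2^-1 ^+ (pickle w).+1.
have half0 k : 0 < 2^-1 ^+ k :> R by rewrite exprn_gt0 // invr_gt0.
have W0 v w : 0 < W v w.
  rewrite /W ltr_wpDl ?mulr_gt0 ?divr_gt0 //.
  by rewrite mulr_ge0 // subr_ge0 ltW.
pose M v w := t * ((E v w)%:R * W v w).
have M0 : nonneg_mat M.
  by move=> v w; rewrite mulr_ge0 ?(ltW t0) // mulr_ge0 ?ler0n // ltW.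
have row_sum v (r : seq V) : uniq r ->
    \sum_(w <- r) M v w <= t * (1 - eps (idx v) / 2).
  move=> ur; rewrite -mulr_sumr ler_pM2l //.
  apply: (@le_trans _ _ (\sum_(w <- r) W v w)).
    by apply: ler_sum => w _; rewrite ler_piMl ?(ltW (W0 _ _)) // lern1 leq_b1.
  rewrite big_split /= -mulr_suml -mulr_sumr.
  have s1 : \sum_(w <- r) (onC v w)%:R <= 1 :> R.
    apply: (@le_trans _ _ (\sum_(w <- r) (w == next (C (idx v)) v)%:R)).
      by apply: ler_sum => w _; rewrite ler_nat /onC; case: (v \in _).
    rewrite -natr_sum lern1; set x := next _ _.
    have -> : (\sum_(w <- r) (w == x))%N = count_mem x r.
      by rewrite -sum1_count [RHS]big_mkcond; apply: eq_bigr => w _ /=; case: (w == x).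
    by rewrite count_uniq_mem // leq_b1.
  have := sum_half_pow_pickle_le1 R ur.
  have := eps0 (idx v); have := eps1 (idx v).
  move: s1; set x := eps _; set s := \sum_(w <- r) _; set s' := \sum_(w <- r) _.
  nra.
have ltM k n : (size (C k) <= n)%N -> ((t * (1 - eps k))%:E <= lambda_n M n)%E.
  move=> kn; have [/eqP c0 /andP[cyc uc]] := cycC k.
  have [f finj cf] := infinite_injective_cover infV uc kn.
  apply: (lambda_n_ge_cycle M0 finj c0 cf) => v vC.
  rewrite /M (next_cycle cyc vC) mul1r ler_pM2l // /W /onC -(idxP _ _ vC) vC eqxx.
  by rewrite mul1r lerDl ltW // mulr_gt0 ?divr_gt0.
have d0 v : 0 < eps (idx v) / 2 by rewrite divr_gt0.
have lambdaE : lambda M = t%:E.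
  apply/eqP; rewrite eq_le (lambda_le_row_sum M0 t0 d0 row_sum) /=.
  apply/lee_addgt0Pr => e e0.
  pose k := Num.truncn (t / e).
  have tk : t * eps k < e.
    have [_ + _] := epsP k; rewrite -(ltr_pM2l t0) => /lt_trans; apply.
    by rewrite ltr_pdivrMr ?ltr0n // mulrC -ltr_pdivrMr // truncnS_gt.
  apply: (@le_trans _ _ ((t * (1 - eps k))%:E + e%:E)%E).
    rewrite -EFinD lee_fin; move: tk; lra.
  rewrite leeD2r // (le_trans (ltM k _ (leqnn _))) //.
  exact: lambda_n_le_lambda.
exists M.
  split=> //; last 2 first.
  - by rewrite lambdaE ltry.
  - exact: (transient_row_sum M0 t0 d0 row_sum lambdaE).
  move=> v w; rewrite /digraph_of /= /M mulf_eq0 gt_eqF //= mulf_eq0 (gt_eqF (W0 _ _)) orbF.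
  by rewrite pnatr_eq0 eqb0 negbK.
move=> n n0; rewrite lambdaE.
suff [x xl tx] : exists2 x, (x%:E <= lambda_n M n)%E & t - x < g n.
  apply: (@le_lt_trans _ _ (t - x)%:E); last by rewrite lte_fin.
  by rewrite EFinB leeB.
have [nC0|C0n] := ltnP n (size (C 0%N)).
  by exists 0; [exact: lambda_n_ge0 | rewrite subr0 tg // mem_iota].
have gapE k : t - t * (1 - eps k) = t * eps k by ring.
(* If some cycle is longer than [n], the one just before the first such cycle fits, and its [eps]
   was chosen for orders up to the length of the next. Otherwise all cycles fit, and [k] is taken
   with [t / (k + 1) < g n]. *)
have [big|small] := pselect (exists k, (n < size (C k))%N).
  case: (ex_minnP big) => -[|k] nk kmin; first by rewrite ltnNge C0n in nk.
  exists (t * (1 - eps k)); last first.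
    by rewrite gapE; have [_ _] := epsP k; apply; rewrite ltnS ltnW.
  by apply: ltM; rewrite leqNgt; apply/negP => /kmin; rewrite ltnn.
pose k := Num.truncn (t / g n).
exists (t * (1 - eps k)).
  by apply: ltM; rewrite leqNgt; apply/negP => ?; apply: small; exists k.
rewrite gapE; have [_ + _] := epsP k; rewrite -(ltr_pM2l t0) => /lt_trans; apply.
by rewrite ltr_pdivrMr ?ltr0n // mulrC -ltr_pdivrMr // truncnS_gt.
Qed.

(** * Incompatibility of the two rates and the resulting dichotomy *)

Theorem theorem2 (R : realType) (V : countType) (E : rel V)
    (strongE : strong E) :
  [/\ arbitrarily_fast_approx R E \/ inverse_linear_gap R E,
      ~ (arbitrarily_fast_approx R E /\ inverse_linear_gap R E)
    & inverse_linear_gap R E <->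
      exists S : set V, finite_set S /\ cycle_transversal E S].
Proof.
have exclusive : ~ (arbitrarily_fast_approx R E /\ inverse_linear_gap R E).
  (* This [g] makes [n * g n] smaller than [1 / n], hence smaller than the constant [c] of the
     matrix supplied by [fast] once [n > 1 / c]. *)
  move=> [/(_ (fun n => n.+1%:R ^- 2)) fast slow].
  have [n|M TM gap] := fast; first by rewrite invr_gt0 exprn_gt0 // ltr0n.
  have [c c0 cgap] := slow _ TM.
  pose n := (Num.truncn c^-1).+1.
  have n0 : 0 < n%:R :> R by rewrite ltr0n.
  have := lt_trans (cgap n isT) (_ : _ < (n%:R * n.+1%:R ^- 2)%:E)%E.
  rewrite EFinM lte_pmul2l ?lte_fin ?gap // => /(_ isT); apply/negP.
  rewrite -leNgt; apply: (@le_trans _ _ n%:R^-1).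
    rewrite ler_pdivrMr ?exprn_gt0 ?ltr0n // ler_pdivlMl //.
    rewrite -natr1; nra.
  by rewrite invf_ple ?posrE // ltW // truncnS_gt.
have [[S [Sfin tS]]|noS] := pselect (exists S, finite_set S /\ cycle_transversal E S).
  have gap := transversal_inverse_linear_gap (R := R) strongE Sfin tS.
  by split=> //; [right | split=> // _; exists S].
have fast : arbitrarily_fast_approx R E.
  by apply: no_transversal_arbitrarily_fast => S Sfin tS; apply: noS; exists S.
(* Exclusivity also gives the converse: without a finite transversal (A) holds, so (B) fails. *)
by split=> //; [left | split=> // gap; case: exclusive].
Qed.
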